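(* For every positive integer $k$ there exists a finite family of polygonal $2$-chains in the plane whose disjointness graph is triangle-free and has chromatic number at least $k$.
   Context: A polygonal $k$-chain is a continuous curve in the plane consisting of $k$ straight-line segments $s_1,\dots,s_k$, where consecutive segments $s_i,s_{i+1}$ share an endpoint. The disjointness graph of a finite family of subsets of the plane is the graph whose vertices are the members of the family, two being adjacent if and only if they are disjoint. *)

(* Defs.v *)
From Stdlib Require Import Reals Lra.
Open Scope R_scope.

Definition pt := (R * R)%type.

Definition segment (p q : pt) : pt -> Prop :=
  fun x => exists t : R, 0 <= t <= 1 /\
    fst x = (1 - t) * fst p + t * fst q /\
    snd x = (1 - t) * snd p + t * snd q.

(* A polygonal 2-chain: segments s1 = [a, b] and s2 = [b, c] sharing the
   endpoint b; segments are non-degenerate. *)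
Record chain2 := Chain2 {
  ch_a : pt; ch_b : pt; ch_c : pt;
  ch_ab : ch_a <> ch_b;
  ch_bc : ch_b <> ch_c }.

Definition chain_set (c : chain2) : pt -> Prop :=
  fun x => segment (ch_a c) (ch_b c) x \/ segment (ch_b c) (ch_c c) x.

Definition disjoint_sets (A B : pt -> Prop) : Prop :=
  forall x, ~ (A x /\ B x).

Definition triangle_free (n : nat) (adj : nat -> nat -> Prop) : Prop :=
  ~ exists i j l, (i < n)%nat /\ (j < n)%nat /\ (l < n)%nat /\
      adj i j /\ adj j l /\ adj i l.

Definition colorable (n : nat) (adj : nat -> nat -> Prop) (m : nat) : Prop :=
  exists col : nat -> nat,
    (forall i, (i < n)%nat -> (col i < m)%nat) /\
    (forall i j, (i < n)%nat -> (j < n)%nat -> adj i j -> col i <> col j).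

Definition chromatic_ge (n : nat) (adj : nat -> nat -> Prop) (k : nat) : Prop :=
  forall m, (m < k)%nat -> ~ colorable n adj m.

Definition disj_graph (F : nat -> chain2) : nat -> nat -> Prop :=
  fun i j => disjoint_sets (chain_set (F i)) (chain_set (F j)).

(* Main.v *)
(* Realize the shift graph: vertices are the pairs i < j, and (i, j), (k, l)
   are adjacent iff j = k or l = i. It is triangle-free, and m colours suffice
   only on at most 2^m indices.
   Choose 0 < p_0 < q_0 < p_1 < q_1 < ... growing fast, put P_i on y = -x^2 at
   x = p_i and Q_j on y = x^2 at x = -q_j. The chain of (i, j) goes from P_i
   to its apex Q_j, and from there along a chord of y = x^2 that returns to the
   parabola between Q_i and Q_(i+1), up to a far vertical line x = X. This
   second segment passes above Q_m exactly for i < m < j and separates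
   P_0, ..., P_j (above it) from the later P_m. Comparing heights at two
   abscissas shows that chains of (i, j) and (k, l) with i < k cross unless
   j = k, while for j = k each segment of one chain is separated from each
   segment of the other by the line carrying one of them. *)
Require Import Defs.
From Stdlib Require Import Reals.
From Stdlib Require Import Lra Lia List Arith ClassicalEpsilon.
Open Scope R_scope.

Set Implicit Arguments.

(** * Crossing and separation of segments *)

Lemma segment_sym (p q z : pt) : segment p q z -> segment q p z.
Proof.
  intros [t [Ht [H1 H2]]]. exists (1 - t).
  split; [lra|]. split; [rewrite H1 | rewrite H2]; ring.
Qed.

Lemma segment_left (p q : pt) : segment p q p.
Proof. exists 0. split; [lra|]. split; ring. Qed.

Lemma segment_right (p q : pt) : segment p q q.
Proof. apply segment_sym, segment_left. Qed.

Lemma segment_graph (p q : pt) (a b x : R) :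
  fst p < fst q -> fst p <= x <= fst q ->
  snd p = a * fst p + b -> snd q = a * fst q + b ->
  segment p q (x, a * x + b).
Proof.
  intros Hpq Hx Hp Hq. exists ((x - fst p) / (fst q - fst p)). cbn [fst snd].
  split; [split|split].
  - apply Rmult_le_pos; [lra|]. left. apply Rinv_0_lt_compat. lra.
  - apply Rmult_le_reg_r with (fst q - fst p); [lra|].
    unfold Rdiv. rewrite Rmult_assoc, Rinv_l; lra.
  - field. lra.
  - rewrite Hp, Hq. field. lra.
Qed.

(** The difference of the two affine functions changes sign between x and y, where both segments are
    defined; its zero [w] gives the common point. *)
Lemma segment_cross (p q p' q' : pt) (a b a' b' x y : R) :
  fst p < fst q -> snd p = a * fst p + b -> snd q = a * fst q + b ->
  fst p' < fst q' -> snd p' = a' * fst p' + b' -> snd q' = a' * fst q' + b' ->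
  x < y ->
  fst p <= x -> fst p' <= x -> y <= fst q -> y <= fst q' ->
  a * x + b < a' * x + b' -> a' * y + b' < a * y + b ->
  exists z, segment p q z /\ segment p' q' z.
Proof.
  intros Hpq Hp Hq Hpq' Hp' Hq' Hxy ? ? ? ? Hx Hy.
  assert (Ha : 0 < a - a') by nra.
  pose (w := (b' - b) / (a - a')).
  assert (Hw : w * (a - a') = b' - b) by (unfold w; field; lra).
  assert (x <= w) by (apply Rmult_le_reg_r with (a - a'); lra).
  assert (w <= y) by (apply Rmult_le_reg_r with (a - a'); lra).
  exists (w, a * w + b). split.
  - apply segment_graph; lra.
  - replace (a * w + b) with (a' * w + b') by lra. apply segment_graph; lra.
Qed.

(** The height above the line is affine along the second segment, so with the same strict sign at
    both ends it never vanishes. *)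
Lemma segment_separated (p q p' q' : pt) (a b : R) :
  snd p = a * fst p + b -> snd q = a * fst q + b ->
  (a * fst p' + b < snd p' /\ a * fst q' + b < snd q' \/
   snd p' < a * fst p' + b /\ snd q' < a * fst q' + b) ->
  forall z, segment p q z -> segment p' q' z -> False.
Proof.
  intros Hp Hq Hs z [t [Ht [H1 H2]]] [r [Hr [H3 H4]]].
  assert (E : snd z = a * fst z + b) by (rewrite H1, H2, Hp, Hq; ring).
  assert (E' : (1 - r) * (snd p' - (a * fst p' + b))
             + r * (snd q' - (a * fst q' + b)) = 0).
  { rewrite H3, H4 in E. lra. }
  (* One of the weights r and 1 - r is at least 1/2, which keeps the sum away from zero. *)
  destruct (Rle_lt_dec r (1 / 2)), Hs as [[? ?]|[? ?]]; nra.
Qed.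

Lemma segment_fst_ge (p q z : pt) (c : R) :
  c <= fst p -> c <= fst q -> segment p q z -> c <= fst z.
Proof. intros Hp Hq [t [Ht [H _]]]. rewrite H. nra. Qed.

Lemma segment_fst_le (p q z : pt) (c : R) :
  fst p <= c -> fst q <= c -> segment p q z -> fst z <= c.
Proof. intros Hp Hq [t [Ht [H _]]]. rewrite H. nra. Qed.

(** * Points and lines of the construction, and their relative positions *)

Definition e (i : nat) : R := 16 ^ i.

Lemma e_pos (i : nat) : 0 < e i.
Proof. apply pow_lt. lra. Qed.

Lemma e_lt (i j : nat) : (i < j)%nat -> 16 * e i <= e j.
Proof.
  intros H. unfold e. change (16 * 16 ^ i) with (16 ^ S i).
  apply Rle_pow; [lra | lia].
Qed.

(** Here p_i = [e i] and q_j = [4 * e j]. The ratio 16 leaves room for the abscissa -16 e_i between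
    those of [Q i] and [Q (S i)], which are -4 e_i and -64 e_i. *)
Definition P (i : nat) : pt := (e i, - (e i * e i)).
Definition Q (j : nat) : pt := (- (4 * e j), 16 * (e j * e j)).

(* The line [y = ta i j * x + tb i j] is the chord of the parabola [y = x^2]
   through [Q j] and the point with abscissa [- 16 e_i], which lies between
   [Q i] and [Q (S i)]. *)
Definition ta (i j : nat) : R := - (4 * e j + 16 * e i).
Definition tb (i j : nat) : R := - (64 * (e i * e j)).
Definition T (X : R) (i j : nat) : pt := (X, ta i j * X + tb i j).

(** Slope and intercept of the line through [P i] and [Q j]. *)
Definition sa (i j : nat) : R :=
  - ((16 * (e j * e j) + e i * e i) / (4 * e j + e i)).
Definition sb (i j : nat) : R := - (e i * e i) - sa i j * e i.

Lemma P_on_s (i j : nat) : snd (P i) = sa i j * fst (P i) + sb i j.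
Proof. unfold sb. cbn [P fst snd]. ring. Qed.

Lemma Q_on_s (i j : nat) : snd (Q j) = sa i j * fst (Q j) + sb i j.
Proof.
  unfold sb, sa. cbn [Q fst snd].
  pose proof (e_pos i). pose proof (e_pos j). field. lra.
Qed.

Lemma Q_on_t (i j : nat) : snd (Q j) = ta i j * fst (Q j) + tb i j.
Proof. unfold ta, tb. cbn [Q fst snd]. ring. Qed.

(** The slope is close to -4 e_j; this linear bound replaces the quotient in later comparisons. *)
Lemma sa_bound (i j : nat) : (i < j)%nat -> sa i j <= - (3 * e j).
Proof.
  intros H. unfold sa. pose proof (e_pos i). pose proof (e_lt H).
  apply Ropp_le_contravar, Rmult_le_reg_r with (4 * e j + e i); [lra|].
  unfold Rdiv. rewrite (Rmult_assoc _ (/ _)), Rinv_l by lra. nra.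
Qed.

(** On the parabola, x^2 - (ta x + tb) = (x + 4 e_j)(x + 16 e_i). The signs of such factors decide
    this and the next two lemmas. *)
Lemma Q_above_t_left (i j l : nat) : (i < j)%nat -> (j < l)%nat ->
  ta i j * fst (Q l) + tb i j < snd (Q l).
Proof.
  intros Hij Hjl. unfold ta, tb. cbn [Q fst snd].
  pose proof (e_pos i). pose proof (e_lt Hij). pose proof (e_lt Hjl). nra.
Qed.

Lemma Q_above_t_right (j l : nat) : (j < l)%nat ->
  ta j l * fst (Q j) + tb j l < snd (Q j).
Proof.
  intros H. unfold ta, tb. cbn [Q fst snd].
  pose proof (e_pos j). pose proof (e_lt H). nra.
Qed.

Lemma Q_below_t (k m l : nat) : (k < m)%nat -> (m < l)%nat ->
  snd (Q m) < ta k l * fst (Q m) + tb k l.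
Proof.
  intros Hkm Hml. unfold ta, tb. cbn [Q fst snd].
  pose proof (e_pos k). pose proof (e_lt Hkm). pose proof (e_lt Hml).
  assert (0 < (e l - e m) * (e m - 4 * e k)) by (apply Rmult_lt_0_compat; lra).
  nra.
Qed.

(** The comparison is of e_i^2 with a quantity exceeding 4 e_l e_i, which wins while e_i <= e_l. In
    the next lemma the 16-fold growth lets the square win. *)
Lemma P_above_t (i k l : nat) : (i <= l)%nat ->
  ta k l * fst (P i) + tb k l < snd (P i).
Proof.
  intros H. unfold ta, tb. cbn [P fst snd].
  pose proof (e_pos i). pose proof (e_pos k). pose proof (e_pos l).
  assert (e i <= e l) by (apply Rle_pow; [lra | exact H]). nra.
Qed.

Lemma P_below_t (k l m : nat) : (k < l)%nat -> (l < m)%nat ->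
  snd (P m) < ta k l * fst (P m) + tb k l.
Proof.
  intros Hkl Hlm. unfold ta, tb. cbn [P fst snd].
  pose proof (e_pos k). pose proof (e_lt Hkl). pose proof (e_lt Hlm).
  assert (16 * (e l * e m) <= e m * e m) by nra.
  assert (16 * (e k * e m) <= e l * e m) by nra.
  assert (e k * e l <= e k * e m) by nra. nra.
Qed.

(** Leftwards from [P k] the line rises with slope at least 3 e_l >= 48 e_k, which outpaces the
    climb to [Q j]. The same steepness gives the next lemma. *)
Lemma Q_below_s (j k l : nat) : (j <= k)%nat -> (k < l)%nat ->
  snd (Q j) < sa k l * fst (Q j) + sb k l.
Proof.
  intros Hjk Hkl. unfold sb. cbn [Q fst snd].
  pose proof (sa_bound Hkl). pose proof (e_pos j). pose proof (e_lt Hkl).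
  assert (e j <= e k) by (apply Rle_pow; [lra | exact Hjk]).
  assert (48 * e k * (4 * e j + e k) <= - sa k l * (4 * e j + e k))
    by (apply Rmult_le_compat_r; lra). nra.
Qed.

Lemma P_below_s (i j l : nat) : (i < j)%nat -> (j < l)%nat ->
  snd (P i) < sa j l * fst (P i) + sb j l.
Proof.
  intros Hij Hjl. unfold sb. cbn [P fst snd].
  pose proof (sa_bound Hjl). pose proof (e_pos i).
  pose proof (e_lt Hij). pose proof (e_lt Hjl).
  assert (0 < (- sa j l - (e i + e j)) * (e j - e i))
    by (apply Rmult_lt_0_compat; lra). nra.
Qed.

(** * The chains, and which of them meet *)

Lemma P_neq_Q (i j : nat) : P i <> Q j.
Proof. intros E. injection E. pose proof (e_pos i). pose proof (e_pos j). lra. Qed.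

Lemma Q_neq_T (N i j : nat) : Q j <> T (e N) i j.
Proof. intros E. injection E. pose proof (e_pos N). pose proof (e_pos j). lra. Qed.

Definition chain (N i j : nat) : chain2 :=
  {| ch_a := P i; ch_b := Q j; ch_c := T (e N) i j;
     ch_ab := @P_neq_Q i j; ch_bc := @Q_neq_T N i j |}.

Lemma chain_disjoint (N i j l : nat) : (i < j)%nat -> (j < l)%nat ->
  disjoint_sets (chain_set (chain N i j)) (chain_set (chain N j l)).
Proof.
  intros Hij Hjl z [H1 H2]. unfold chain_set in H1, H2.
  cbn [chain ch_a ch_b ch_c] in H1, H2.
  (* The separating line carries, in turn: the first segment of (j, l), its second segment, the
     second segment of (i, j), the second segment of (j, l). *)
  destruct H1 as [H1|H1], H2 as [H2|H2].
  - apply (segment_separated (P_on_s j l) (Q_on_s j l)) with (3 := H1) (2 := H2).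
    right. split; [apply P_below_s | apply Q_below_s]; lia.
  - apply (segment_separated (Q_on_t j l) (eq_refl : snd (T (e N) j l) = _))
      with (3 := H1) (2 := H2).
    left. split; [apply P_above_t; lia | apply Q_above_t_right, Hjl].
  - apply (segment_separated (Q_on_t i j) (eq_refl : snd (T (e N) i j) = _))
      with (3 := H2) (2 := H1).
    left. split; [apply P_above_t; lia | apply Q_above_t_left; assumption].
  - apply (segment_separated (Q_on_t j l) (eq_refl : snd (T (e N) j l) = _))
      with (3 := H1) (2 := H2).
    (* At the far end, where x > 0, the line of (j, l) is lower because both its slope and its
       intercept are smaller. *)
    left. split; [apply Q_above_t_right, Hjl |]. unfold T, ta, tb. cbn [fst snd].
    pose proof (e_pos i). pose proof (e_pos N).
    pose proof (e_lt Hij). pose proof (e_lt Hjl).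
    assert (e i * e j < e j * e l) by nra. nra.
Qed.

Definition meets (c d : chain2) : Prop :=
  exists z, chain_set c z /\ chain_set d z.

(** The second segment of (i, j) crosses the first of (k, l) between the abscissas of [Q j] and
    [P k]. *)
Lemma meets_separated (N i j k l : nat) :
  (i < j)%nat -> (j < k)%nat -> (k < l)%nat -> (l < N)%nat ->
  meets (chain N i j) (chain N k l).
Proof.
  intros Hij Hjk Hkl HlN.
  pose proof (e_pos j). pose proof (e_pos k).
  pose proof (e_lt Hjk). pose proof (e_lt Hkl). pose proof (e_lt HlN).
  destruct (@segment_cross (Q j) (T (e N) i j) (Q l) (P k)
    (ta i j) (tb i j) (sa k l) (sb k l) (fst (Q j)) (fst (P k)))
    as [z [Hz Hz']]; try (cbn [fst P Q T]; lra).
  - apply Q_on_t.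
  - reflexivity.
  - apply Q_on_s.
  - apply P_on_s.
  - rewrite <- Q_on_t. apply Q_below_s; lia.
  - rewrite <- P_on_s. apply P_below_t; assumption.
  - exists z. split; [right | left]; [exact Hz | apply segment_sym, Hz'].
Qed.

(** The first segment of (i, j) crosses the second of (k, l) between [Q j], below that chord, and
    [P i], above it. *)
Lemma meets_interleaved (N i j k l : nat) :
  (i < k)%nat -> (k < j)%nat -> (j < l)%nat -> (l < N)%nat ->
  meets (chain N i j) (chain N k l).
Proof.
  intros Hik Hkj Hjl HlN.
  pose proof (e_pos i). pose proof (e_lt Hik). pose proof (e_lt Hkj).
  pose proof (e_lt Hjl). pose proof (e_lt HlN).
  destruct (@segment_cross (Q j) (P i) (Q l) (T (e N) k l)
    (sa i j) (sb i j) (ta k l) (tb k l) (fst (Q j)) (fst (P i)))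
    as [z [Hz Hz']]; try (cbn [fst P Q T]; lra).
  - apply Q_on_s.
  - apply P_on_s.
  - apply Q_on_t.
  - reflexivity.
  - rewrite <- Q_on_s. apply Q_below_t; assumption.
  - rewrite <- P_on_s. apply P_above_t; lia.
  - exists z. split; [left | right]; [apply segment_sym, Hz | exact Hz'].
Qed.

(** The second segments cross: [Q l] is below the chord of (i, j), but at the far line the steeper
    slope, about -4 e_j, has brought that chord lower. *)
Lemma meets_nested (N i j k l : nat) :
  (i < k)%nat -> (k < l)%nat -> (l < j)%nat -> (j < N)%nat ->
  meets (chain N i j) (chain N k l).
Proof.
  intros Hik Hkl Hlj HjN.
  pose proof (e_pos i). pose proof (e_lt Hik). pose proof (e_lt Hkl).
  pose proof (e_lt Hlj). pose proof (e_lt HjN).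
  destruct (@segment_cross (Q l) (T (e N) k l) (Q j) (T (e N) i j)
    (ta k l) (tb k l) (ta i j) (tb i j) (fst (Q l)) (e N))
    as [z [Hz Hz']]; try (cbn [fst P Q T]; lra).
  - apply Q_on_t.
  - reflexivity.
  - apply Q_on_t.
  - reflexivity.
  - rewrite <- Q_on_t. apply Q_below_t; lia.
  - unfold ta, tb.
    assert (0 <= e i * e j) by nra.
    assert (16 * (e k * e l) <= e l * e N) by nra.
    assert (16 * (e l * e N) <= e j * e N) by nra.
    assert (16 * (e k * e N) <= e l * e N) by nra.
    assert (0 < e i * e N) by nra. assert (0 < e l * e N) by nra. lra.
  - exists z. split; right; [exact Hz' | exact Hz].
Qed.

Lemma chain_meets (N i j k l : nat) :
  (i < j)%nat -> (j < N)%nat -> (k < l)%nat -> (l < N)%nat ->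
  j <> k -> l <> i -> meets (chain N i j) (chain N k l).
Proof.
  assert (Hlt : forall i j k l, (i < j)%nat -> (j < N)%nat -> (k < l)%nat ->
    (l < N)%nat -> (i < k)%nat -> j <> k -> meets (chain N i j) (chain N k l)).
  { clear. intros i j k l Hij HjN Hkl HlN Hik Hjk.
    destruct (lt_eq_lt_dec j l) as [[Hjl|Hjl]|Hjl].
    - destruct (lt_dec j k).
      + apply meets_separated; assumption.
      + apply meets_interleaved; lia.
    - subst l. exists (Q j). split; left; apply segment_right.
    - apply meets_nested; assumption. }
  intros Hij HjN Hkl HlN Hjk Hli.
  destruct (lt_eq_lt_dec i k) as [[Hik|Hik]|Hik].
  - apply Hlt; assumption.
  - subst k. exists (P i). split; left; apply segment_left.
  - destruct (Hlt k l i j) as [z [Hz Hz']]; try assumption.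
    exists z. split; assumption.
Qed.

(** * Distinct pairs give distinct point sets *)

Lemma chain_fst_ge (N i j : nat) (z : pt) :
  chain_set (chain N i j) z -> fst (Q j) <= fst z.
Proof.
  pose proof (e_pos i). pose proof (e_pos j). pose proof (e_pos N).
  intros [Hz|Hz]; revert Hz; apply segment_fst_ge;
    cbn [chain ch_a ch_b ch_c P Q T fst]; lra.
Qed.

(** [P i] is above the line of the second segment; it is below the line of the first if i < i', and
    to the right of that segment if i > i'. *)
Lemma P_not_in_chain (N i i' j : nat) : (i < j)%nat -> (i' < j)%nat ->
  chain_set (chain N i' j) (P i) -> i = i'.
Proof.
  intros Hi Hi' [Hz|Hz]; cbn [chain ch_a ch_b ch_c] in Hz.
  - destruct (lt_eq_lt_dec i i') as [[H|H]|H]; [exfalso | exact H | exfalso].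
    (* The point is treated as a degenerate segment from [P i] to itself. *)
    + apply (segment_separated (P_on_s i' j) (Q_on_s i' j)
        (or_intror (conj (P_below_s H Hi') (P_below_s H Hi'))) Hz).
      apply segment_left.
    + pose proof (e_pos i'). pose proof (e_pos j). pose proof (e_lt H).
      apply (@segment_fst_le _ _ _ (e i')) in Hz; cbn [P Q fst] in *; lra.
  - exfalso.
    apply (segment_separated (Q_on_t i' j) (eq_refl : snd (T (e N) i' j) = _)
      (or_introl (conj (P_above_t i' (Nat.lt_le_incl _ _ Hi))
                       (P_above_t i' (Nat.lt_le_incl _ _ Hi)))) Hz).
    apply segment_left.
Qed.

(** The apex is the leftmost point, so the set determines j; then [P i] determines i. *)
Lemma chain_inj (N i j k l : nat) : (i < j)%nat -> (k < l)%nat ->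
  (forall x, chain_set (chain N i j) x <-> chain_set (chain N k l) x) ->
  i = k /\ j = l.
Proof.
  intros Hij Hkl H.
  assert (j = l).
  { assert (H1 : fst (Q l) <= fst (Q j)).
    { apply (@chain_fst_ge N k l), H. left. apply segment_right. }
    assert (H2 : fst (Q j) <= fst (Q l)).
    { apply (@chain_fst_ge N i j), H. left. apply segment_right. }
    cbn [Q fst] in H1, H2. pose proof (e_pos j). pose proof (e_pos l).
    destruct (lt_eq_lt_dec j l) as [[Hjl|Hjl]|Hjl]; [|exact Hjl|];
      pose proof (e_lt Hjl); lra. }
  subst l. split; [|reflexivity].
  apply (@P_not_in_chain N i k j Hij Hkl), H. left. apply segment_left.
Qed.

(** * Colourings of the shift graph *)

(* Splitting the vertices [i] by whether some pair [(i, j)] has the last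
   colour gives two parts neither of which uses that colour. *)
Lemma shift_coloring (c : nat -> nat -> nat) (m : nat) : forall V : list nat,
  NoDup V ->
  (forall i j, In i V -> In j V -> (i < j)%nat -> (c i j < m)%nat) ->
  (forall i j l, In i V -> In j V -> In l V ->
     (i < j)%nat -> (j < l)%nat -> c i j <> c j l) ->
  (length V <= 2 ^ m)%nat.
Proof.
  induction m as [|m IH]; intros V HV Hc Hp.
  - destruct V as [|a [|b V]]; cbn; try lia.
    assert (a <> b) by (intros ->; inversion HV; subst; cbn in *; tauto).
    destruct (lt_dec a b).
    + specialize (Hc a b); cbn in Hc; lia.
    + specialize (Hc b a); cbn in Hc; lia.
  - pose (f := fun i => existsb (fun j => (i <? j)%nat && (c i j =? m)%nat)%bool V).
    assert (Hf : forall i, f i = true <->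
      exists j, In j V /\ (i < j)%nat /\ c i j = m).
    { intros i. unfold f. rewrite existsb_exists.
      split; intros [j [Hj H]]; exists j.
      - apply andb_prop in H. rewrite Nat.ltb_lt, Nat.eqb_eq in H. tauto.
      - split; [exact Hj|]. apply andb_true_intro.
        rewrite Nat.ltb_lt, Nat.eqb_eq. tauto. }
    assert (Hg : forall g : nat -> bool,
      (forall i j, In i V -> In j V -> (i < j)%nat ->
         g i = true -> g j = true -> c i j <> m) ->
      (length (filter g V) <= 2 ^ m)%nat).
    { intros g Hg. apply IH.
      - apply NoDup_filter, HV.
      - intros i j Hi Hj Hij. apply filter_In in Hi, Hj.
        assert (c i j < S m)%nat by (apply Hc; tauto).
        assert (c i j <> m) by (apply Hg; tauto). lia.
      - intros i j l Hi Hj Hl. apply filter_In in Hi, Hj, Hl.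
        apply Hp; tauto. }
    rewrite <- (filter_length f V). cbn [Nat.pow].
    assert (length (filter f V) <= 2 ^ m)%nat.
    (* If c i j = m with j in this part, some c j l = m as well, so the colouring is not proper. *)
    { apply Hg. intros i j Hi Hj Hij _ Hfj E.
      apply Hf in Hfj. destruct Hfj as [l [Hl [Hjl El]]].
      apply (Hp i j l); congruence. }
    assert (length (filter (fun x => negb (f x)) V) <= 2 ^ m)%nat.
    { apply Hg. intros i j Hi Hj Hij Hfi _ E.
      assert (f i = true) by (apply Hf; exists j; tauto).
      rewrite H0 in Hfi. discriminate. }
    lia.
Qed.

(** * Indexing the pairs, and the final family *)

Definition pair_eq_dec (p q : nat * nat) : {p = q} + {p <> q}.
Proof. decide equality; apply Nat.eq_dec. Defined.

Definition shift_vertices (N : nat) : list (nat * nat) :=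
  nodup pair_eq_dec (filter (fun p => (fst p <? snd p)%nat) (list_prod (seq 0 N) (seq 0 N))).

Lemma in_shift_vertices (N i j : nat) :
  In (i, j) (shift_vertices N) <-> (i < j /\ j < N)%nat.
Proof.
  unfold shift_vertices. rewrite nodup_In, filter_In, in_prod_iff, !in_seq.
  cbn [fst snd]. rewrite Nat.ltb_lt. lia.
Qed.

Lemma NoDup_shift_vertices (N : nat) : NoDup (shift_vertices N).
Proof. apply NoDup_nodup. Qed.

Unset Implicit Arguments.

Theorem theorem1 : forall k : nat, (1 <= k)%nat ->
  exists (n : nat) (F : nat -> chain2),
    (* the members of the family are distinct subsets of the plane *)
    (forall i j, (i < n)%nat -> (j < n)%nat ->
       (forall x, chain_set (F i) x <-> chain_set (F j) x) -> i = j) /\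
    triangle_free n (disj_graph F) /\
    chromatic_ge n (disj_graph F) k.
Proof.
  intros k _.
  (* More indices than the 2^m that m < k colours allow. *)
  pose (N := S (2 ^ k)).
  pose (L := shift_vertices N).
  (* The default (0, 0) is never reached for a < [length L]. *)
  pose (pr := fun a => nth a L (0, 0)%nat).
  exists (length L), (fun a => chain N (fst (pr a)) (snd (pr a))).
  assert (Hpr : forall a, (a < length L)%nat ->
    (fst (pr a) < snd (pr a) /\ snd (pr a) < N)%nat).
  { intros a Ha. apply in_shift_vertices. rewrite <- surjective_pairing.
    apply nth_In, Ha. }
  assert (Hadj : forall a b, (a < length L)%nat -> (b < length L)%nat ->
    disj_graph (fun a => chain N (fst (pr a)) (snd (pr a))) a b ->
    snd (pr a) = fst (pr b) \/ snd (pr b) = fst (pr a)).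
  { intros a b Ha Hb H. apply Hpr in Ha, Hb.
    destruct (Nat.eq_dec (snd (pr a)) (fst (pr b))) as [|H1]; [tauto|].
    destruct (Nat.eq_dec (snd (pr b)) (fst (pr a))) as [|H2]; [tauto|].
    destruct (@chain_meets N (fst (pr a)) (snd (pr a)) (fst (pr b)) (snd (pr b)))
      as [z Hz]; try tauto.
    destruct (H z Hz). }
  split; [|split].
  - intros a b Ha Hb H.
    destruct (chain_inj (proj1 (Hpr a Ha)) (proj1 (Hpr b Hb)) H) as [H1 H2].
    apply (proj1 (NoDup_nth L (0, 0)%nat) (NoDup_shift_vertices N)); trivial.
    apply injective_projections; assumption.
  - intros (a & b & d & Ha & Hb & Hd & Hab & Hbd & Had).
    apply Hadj in Hab, Hbd, Had; trivial.
    (* A cyclic triangle would make the indices increase around a cycle; a transitive one would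
       force some pair to have equal entries. *)
    apply Hpr in Ha, Hb, Hd. lia.
  - intros m Hm [col [Hcol Hprop]].
    (* Moves the colouring from list positions to pairs by choosing a position of (i, j). *)
    pose (c := fun i j => col (epsilon (inhabits 0%nat)
      (fun a => (a < length L)%nat /\ pr a = (i, j)))).
    assert (Hc : forall i j, (i < j)%nat -> (j < N)%nat ->
      exists a, (a < length L)%nat /\ pr a = (i, j) /\ c i j = col a).
    { intros i j Hij HjN. eexists.
      apply and_assoc. split; [|reflexivity].
      apply epsilon_spec, In_nth, in_shift_vertices. tauto. }
    assert (HN : (length (seq 0 N) <= 2 ^ m)%nat).
    { apply (@shift_coloring c).
      - apply seq_NoDup.
      - intros i j _ Hj Hij. apply in_seq in Hj.
        destruct (Hc i j) as (a & Ha & _ & ->); [lia | lia | apply Hcol, Ha].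
      - intros i j l _ _ Hl Hij Hjl. apply in_seq in Hl.
        destruct (Hc i j) as (a & Ha & Ea & ->); [lia | lia |].
        destruct (Hc j l) as (b & Hb & Eb & ->); [lia | lia |].
        apply Hprop; trivial. unfold disj_graph. rewrite Ea, Eb.
        apply chain_disjoint; assumption. }
    rewrite length_seq in HN.
    assert (2 ^ m <= 2 ^ k)%nat by (apply Nat.pow_le_mono_r; lia).
    unfold N in HN. lia.
Qed.
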